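(* Let $\lambda$ be a partition whose $2$-quotient satisfies the shifted condition, and let $S\in\mathsf{MSShDT}(\lambda)$. Then \[\sum_{\substack{T\in\mathsf{SSShDT}(\lambda)\\ \mathrm{std}(T)=S}}x^{\mathrm{wt}(T)}=F^B_{\mathrm{Des}(S)},\] where $F^B$ is taken in degree $n$, the number of dominoes of $S$.
   Context: Young diagrams are in English convention. The $2$-quotient of $\lambda=(\lambda_1,\dots,\lambda_k)$: let $\lambda^\star=(\lambda_i+k-i)_i$; let $w$ be obtained from $\lambda^\star$ by replacing its odd parts, from right to left, by $1,3,5,\dots$ and its even parts, from right to left, by $0,2,4,\dots$; $\mu$ (resp. $\nu$) is obtained by subtracting position by position the even (resp. odd) entries of $w$ from the even (resp. odd) entries of $\lambda^\star$, dividing by $2$, removing zeros. Shifted condition: $\mu=(\mu_1,\dots,\mu_p)$, $\nu=(\nu_1,\dots,\nu_q)$ with $\mu_p\ge p$, $\nu_q\ge q$. A domino tiling of $\lambda$ is shifted if there is no vertical domino $d$ on the main diagonal such that all dominoes left of and adjacent to $d$ are strictly below the main diagonal. A semistandard shifted domino tableau of shape $\lambda$ is, for some shifted tiling, a filling of the dominoes lying weakly above the main diagonal with entries from the totally ordered set $0<1'<1<2'<2<\cdots$ such that (1) entries weakly increase left to right along rows and top to bottom in columns; (2) each row contains at most one $i'$ and each column at most one $i$ (for each $i$); (3) the northwest-most domino may contain $0$ only if it is horizontal. $\mathsf{SSShDT}(\lambda)$ is their set; $\mathrm{wt}_i(T)$ is the number of entries equal to $i$ or $i'$ ($\mathrm{wt}_0(T)$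 = number of $0$'s), and $x^{\mathrm{wt}(T)}=\prod_{i\ge0}x_i^{\mathrm{wt}_i(T)}$. A standard shifted domino tableau is a bijective filling of the dominoes weakly above the diagonal in a shifted tiling with $[m]$ ($m$ = number of those dominoes), strictly increasing along rows and down columns; a marked one additionally has each entry primed or unprimed; $\mathsf{MSShDT}(\lambda)$ is the set of these. $\mathrm{dom}_i(S)$ is the domino containing $i$ or $i'$, and $\mathrm{demark}(S)$ removes primes. For an unmarked $Q$ with $n$ dominoes, $i\in[0,n-1]$ is a descent if $i=0$ and $\mathrm{dom}_1(Q)$ is vertical, or $i>0$ and $\mathrm{dom}_{i+1}(Q)$ is strictly lower than $\mathrm{dom}_i(Q)$ (both its cells in rows strictly below both cells of $\mathrm{dom}_i(Q)$). For marked $S$, $i\in[0,n-1]$ is a descent if: $i=0$ and ($1'$ is in $S$ or $\mathrm{dom}_1(S)$ is vertical); or $i>0$, $i$ is in $S$ unprimed and $i$ is a descent of $\mathrm{demark}(S)$; or $i>0$, $(i+1)'$ is in $S$ and $i$ is not a descent of $\mathrm{demark}(S)$. $\mathrm{Des}(S)$ is the descent set. Standardization $\mathrm{std}(T)\in\mathsf{MSShDT}(\lambda)$ of $T\in\mathsf{SSShDT}(\lambda)$: let $n_1<\cdots<n_r$ be the positive $i$ with $\mathrm{wt}_i(T)\ne0$; replace the $0$ entries from left to right by $1,\dots,\mathrm{wt}_0(T)$; then replace the entries $n_1',n_1$ by $\mathrm{wt}_0(T)+1,\dots,\mathrm{wt}_0(T)+\mathrm{wt}_{n_1}(T)$, primed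 entries becoming primed integers and unprimed becoming unprimed, first the entries $n_1'$ from top to bottom and then the entries $n_1$ from left to right; continue likewise with $n_2$, etc. $F^B_I=\sum x_{i_1}\cdots x_{i_n}$ over integers $0=i_0\le i_1\le\cdots\le i_n$ with $i_j<i_{j+1}$ whenever $j\in I$. *)

(* Defs.v *)
From mathcomp Require Import all_boot ssrint finmap.
From mathcomp Require Import boolp classical_sets cardinality.

Set Implicit Arguments.
Unset Strict Implicit.
Unset Printing Implicit Defensive.

Definition is_partition (la : seq nat) : bool :=
  sorted geq la && (0 \notin la).

Definition lambda_star (la : seq nat) : seq nat :=
  [seq nth 0 la i + (size la - i.+1) | i <- iota 0 (size la)].

(* Numbering the odd (resp. even) parts from right to left by 1, 3, 5, ...
   (resp. 0, 2, 4, ...) gives to the part in position i its parity plus twice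
   the number of parts of the same parity strictly to its right. *)
Definition renumber (s : seq nat) : seq nat :=
  [seq odd (nth 0 s i) + 2 * count (fun a => odd a == odd (nth 0 s i)) (drop i.+1 s)
     | i <- iota 0 (size s)].

Definition quotient_part (b : bool) (la : seq nat) : seq nat :=
  let s := lambda_star la in
  let w := renumber s in
  [seq m <- [seq (nth 0 s i - nth 0 w i) %/ 2
               | i <- iota 0 (size s) & odd (nth 0 s i) == b] | m != 0].

Definition two_quotient (la : seq nat) : seq nat * seq nat :=
  (quotient_part false la, quotient_part true la).

Definition shifted_condition (q : seq nat * seq nat) : bool :=
  (size q.1 <= last 0 q.1) && (size q.2 <= last 0 q.2).

(* (row, column), both counted from 0, rows going down *)
Definition cell := (nat * nat)%type.

Definition in_diagram (la : seq nat) (x : cell) : bool := x.2 < nth 0 la x.1.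

(* the northwest cell, and whether the domino is vertical *)
Definition domino := (cell * bool)%type.

Definition vertical (d : domino) : bool := d.2.

Definition cells (d : domino) : seq cell :=
  let: (r, c, v) := d in [:: (r, c); if v then (r.+1, c) else (r, c.+1)].

Definition top_row (d : domino) : nat := d.1.1.
Definition left_column (d : domino) : nat := d.1.2.

Definition is_tiling (la : seq nat) (t : {fset domino}) : Prop :=
  (forall d, d \in t -> all (in_diagram la) (cells d)) /\
  (forall x, in_diagram la x -> exists! d, d \in t /\ x \in cells d).

Definition on_diagonal (d : domino) : bool := has (fun x => x.1 == x.2) (cells d).

Definition strictly_below_diagonal (d : domino) : bool :=
  all (fun x => x.2 < x.1) (cells d).

(* Hence a domino crossing the diagonal, with one cell on it and one cell
   strictly below it, counts as weakly above the diagonal. *)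
Definition weakly_above_diagonal (d : domino) : bool :=
  ~~ strictly_below_diagonal d.

Definition left_adjacent (e d : domino) : bool :=
  (e != d) &&
  has (fun x => has (fun y => (x.1 == y.1) && (x.2.+1 == y.2)) (cells d)) (cells e).

(* "All dominoes left of and adjacent to d" presupposes that there is one: a
   vertical domino in the first column, in particular the one covering the
   northwest corner, violates nothing. *)
Definition bad_domino (t : {fset domino}) (d : domino) : Prop :=
  [/\ vertical d, on_diagonal d,
      (exists2 e, e \in t & left_adjacent e d)
    & forall e, e \in t -> left_adjacent e d -> strictly_below_diagonal e].

Definition shifted_tiling (la : seq nat) (t : {fset domino}) : Prop :=
  is_tiling la t /\ ~ (exists2 d, d \in t & bad_domino t d).

(* D is the set of dominoes to be filled in some shifted tiling of la. The part
   of the tiling strictly below the diagonal is not part of a tableau. *)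
Definition shifted_support (la : seq nat) (D : {fset domino}) : Prop :=
  exists2 t, shifted_tiling la t & D = [fset d in t | weakly_above_diagonal d]%fset.

Definition meets_row (r : nat) (d : domino) : bool := has (fun x => x.1 == r) (cells d).
Definition meets_column (c : nat) (d : domino) : bool := has (fun x => x.2 == c) (cells d).

(* distinct dominoes, d to the left of e in some common row *)
Definition precedes_in_row (d e : domino) : bool :=
  (d != e) &&
  has (fun x => has (fun y => (x.1 == y.1) && (x.2 < y.2)) (cells e)) (cells d).

(* distinct dominoes, d above e in some common column *)
Definition precedes_in_column (d e : domino) : bool :=
  (d != e) &&
  has (fun x => has (fun y => (x.2 == y.2) && (x.1 < y.1)) (cells e)) (cells d).

(* The totally ordered alphabet 0 < 1' < 1 < 2' < 2 < ... is represented by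
   the natural numbers with their order: i' is 2i - 1 (for i > 0) and i is 2i.
   There is no letter 0'. *)
Definition letter := nat.
Definition prm (i : nat) : letter := i.*2.-1.
Definition unp (i : nat) : letter := i.*2.
Definition primed (a : letter) : bool := odd a.
Definition value (a : letter) : nat := uphalf a.

Definition filling := {fmap domino -> letter}.

Definition entries (T : filling) : seq letter := [seq T d | d : domf T].

Definition wt (T : filling) (i : nat) : nat :=
  count (fun a => value a == i) (entries T).

Definition SSShDT (la : seq nat) (T : filling) : Prop :=
  shifted_support la (domf T) /\
  [/\ forall d e : domf T,
        precedes_in_row (val d) (val e) || precedes_in_column (val d) (val e) ->
        T d <= T e,
      forall (i r : nat) (d e : domf T), 0 < i ->
        T d = prm i -> T e = prm i ->
        meets_row r (val d) -> meets_row r (val e) -> d = e,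
      forall (i c : nat) (d e : domf T),
        T d = unp i -> T e = unp i ->
        meets_column c (val d) -> meets_column c (val e) -> d = e
    & forall d : domf T, (0, 0) \in cells (val d) -> T d = unp 0 ->
        ~~ vertical (val d)].

Definition ShDT (la : seq nat) (Q : {fmap domino -> nat}) : Prop :=
  [/\ shifted_support la (domf Q),
      perm_eq [seq Q d | d : domf Q] (iota 1 #|` domf Q|)
    & forall d e : domf Q,
        precedes_in_row (val d) (val e) || precedes_in_column (val d) (val e) ->
        Q d < Q e].

Definition demark (S : filling) : {fmap domino -> nat} :=
  [fmap d : domf S => value (S d)]%fmap.

Definition MSShDT (la : seq nat) (S : filling) : Prop := ShDT la (demark S).

Definition strictly_lower (e d : domino) : bool :=
  all (fun x => all (fun y => x.1 < y.1) (cells e)) (cells d).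

Definition descent (Q : {fmap domino -> nat}) (i : nat) : bool :=
  if i == 0 then [exists d : domf Q, (Q d == 1) && vertical (val d)]
  else [exists d : domf Q, [exists e : domf Q,
          [&& Q d == i, Q e == i.+1 & strictly_lower (val e) (val d)]]].

Definition marked_descent (S : filling) (i : nat) : bool :=
  if i == 0 then
    (prm 1 \in entries S)
    || [exists d : domf S, (value (S d) == 1) && vertical (val d)]
  else ((unp i \in entries S) && descent (demark S) i)
       || ((prm i.+1 \in entries S) && ~~ descent (demark S) i).

Definition Des (S : filling) : {set 'I_#|` domf S|} :=
  [set i : 'I_#|` domf S| | marked_descent S i].

Definition dominoes_with (T : filling) (a : letter) : {fset domino} :=
  [fset d in domf T | T.[? d]%fmap == Some a]%fset.

Definition left_to_right (D : {fset domino}) : seq domino :=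
  sort (relpre left_column leq) D.

Definition top_to_bottom (D : {fset domino}) : seq domino :=
  sort (relpre top_row leq) D.

Definition positive_values (T : filling) : seq nat :=
  [seq i <- iota 1 (\max_(a <- entries T) value a) | wt T i != 0].

(* the order in which standardization numbers the dominoes 1, 2, 3, ... *)
Definition std_order (T : filling) : seq domino :=
  left_to_right (dominoes_with T (unp 0)) ++
  flatten [seq top_to_bottom (dominoes_with T (prm i)) ++
               left_to_right (dominoes_with T (unp i))
             | i <- positive_values T].

Definition std (T : filling) : filling :=
  [fmap d : domf T =>
     let k := (index (val d) (std_order T)).+1 in
     if primed (T d) then prm k else unp k]%fmap.

Definition exponent := {fsfun nat -> nat with 0}.

(* a formal power series in x_0, x_1, ... over the integers, as the function
   giving its coefficients *)
Definition series := exponent -> int.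

(* The objects a in X with x^(w a) = x^e, where w a is the exponent vector
   attached to a *)
Definition with_exponent (A : Type) (X : set A) (w : A -> nat -> nat) (e : exponent) :
  set A := [set a | X a /\ w a =1 e]%classic.

(* The sum of the monomials x^(w a), for a in X, is a well-defined formal power
   series. *)
Definition summable (A : Type) (X : set A) (w : A -> nat -> nat) : Prop :=
  forall e, finite_set (with_exponent X w e).

(* That sum; only meaningful when it is summable, as fset_set is empty on
   infinite sets. *)
Definition monomial_sum (A : choiceType) (X : set A) (w : A -> nat -> nat) : series :=
  fun e => Posz #|` fset_set (with_exponent X w e)|.

(* s is (i_1, ..., i_n), and i_0 = 0. *)
Definition FB_index (n : nat) (I : {set 'I_n}) : set (n.-tuple nat) :=
  [set s | forall j : 'I_n,
       nth 0 (0 :: s) j <= nth 0 (0 :: s) j.+1 /\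
       (j \in I -> nth 0 (0 :: s) j < nth 0 (0 :: s) j.+1)]%classic.

Definition FB_exponent (n : nat) (s : n.-tuple nat) (k : nat) : nat := count_mem k s.

Definition FB (n : nat) (I : {set 'I_n}) : series :=
  monomial_sum (FB_index I) (@FB_exponent n).

(* Main.v *)
Require Import Defs.
From mathcomp Require Import all_boot ssrint finmap.
From mathcomp Require Import zify.
From mathcomp Require Import boolp classical_sets cardinality.

(* Read a tableau T off along the numbering of its standardization S as the
   sequence of the values of the letters. Together with S this sequence
   determines T, and a weakly increasing sequence is determined by its content;
   so on both sides the coefficient of each monomial is 0 or 1, and it suffices
   to match tableaux with sequences. In a tableau, two dominoes with the same
   primed letter lie in disjoint rows, two dominoes with the same unprimed letter
   lie in disjoint columns and, as the cell northeast of both is filled, the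
   right one is not strictly lower than the left one; hence the values increase
   at every descent. Conversely, in a standard shifted domino tableau a domino
   with a larger number that is not strictly lower lies entirely to the right, so
   along a run without descents the primed letters go strictly down and the
   following unprimed ones strictly to the right. *)

Set Implicit Arguments.
Unset Strict Implicit.
Unset Printing Implicit Defensive.

(** * Dominoes as rectangles of rows and columns *)

Definition bottom_row (d : domino) : nat := top_row d + vertical d.
Definition right_column (d : domino) : nat := left_column d + ~~ vertical d.

Lemma mem_cells (x : cell) (d : domino) :
  (x \in cells d) = (top_row d <= x.1 <= bottom_row d) &&
                    (left_column d <= x.2 <= right_column d).
Proof.
case: x d => [i j] [[r c] v]; rewrite /cells /bottom_row /right_column !inE /=.
by case: v; rewrite !xpair_eqE /top_row /left_column /=; lia.
Qed.

Lemma strictly_lowerE (d e : domino) : strictly_lower e d = (bottom_row d < top_row e).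
Proof.
case: d e => [[r c] v] [[r' c'] v'].
by rewrite /strictly_lower /bottom_row /top_row /=; case: v; case: v' => /=; lia.
Qed.

Lemma meets_rowE (r : nat) (d : domino) : meets_row r d = (top_row d <= r <= bottom_row d).
Proof.
by case: d => [[i j] v]; rewrite /meets_row /bottom_row /top_row /=; case: v => /=; lia.
Qed.

Lemma meets_columnE (c : nat) (d : domino) :
  meets_column c d = (left_column d <= c <= right_column d).
Proof.
by case: d => [[i j] v]; rewrite /meets_column /right_column /left_column /=; case: v => /=; lia.
Qed.

Lemma precedes_in_rowI (d e : domino) (r c c' : nat) :
  (r, c) \in cells d -> (r, c') \in cells e -> c < c' -> d != e -> precedes_in_row d e.
Proof.
move=> xd ye lt de; rewrite /precedes_in_row de; apply/hasP; exists (r, c) => //.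
by apply/hasP; exists (r, c') => //=; rewrite eqxx.
Qed.

Lemma precedes_in_columnI (d e : domino) (r r' c : nat) :
  (r, c) \in cells d -> (r', c) \in cells e -> r < r' -> d != e -> precedes_in_column d e.
Proof.
move=> xd ye lt de; rewrite /precedes_in_column de; apply/hasP; exists (r, c) => //.
by apply/hasP; exists (r', c) => //=; rewrite eqxx.
Qed.

(** * Regions of dominoes weakly above the diagonal *)

Definition dominoes_disjoint (D : {fset domino}) : Prop :=
  forall d e x, d \in D -> e \in D -> x \in cells d -> x \in cells e -> d = e.

(** Restricted to [r <= c] because the dominoes strictly below the diagonal have been discarded, so
    cells there may be uncovered. *)
Definition northwest_closed (D : {fset domino}) : Prop :=
  forall e x r c, e \in D -> x \in cells e -> r <= x.1 -> c <= x.2 -> r <= c ->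
    exists2 f, f \in D & (r, c) \in cells f.

(** The last clause puts the northeast cell of each domino weakly above the diagonal; northwest
    closure is applied starting from such cells. *)
Definition shifted_region (D : {fset domino}) : Prop :=
  [/\ dominoes_disjoint D, northwest_closed D &
      forall d, d \in D -> top_row d <= right_column d].

Lemma in_diagram_northwest (la : seq nat) (x : cell) (r c : nat) :
  is_partition la -> in_diagram la x -> r <= x.1 -> c <= x.2 -> in_diagram la (r, c).
Proof.
case: x => i j /andP[la_sorted _]; rewrite /in_diagram /= => lt_j le_r le_c.
apply: leq_ltn_trans le_c (leq_trans lt_j _).
have [lt_i|ge_i] := ltnP i (size la); last by rewrite nth_default in lt_j.
have geq_trans : transitive geq by move=> ? ? ? /[swap]; apply: leq_trans.
exact: (sorted_leq_nth geq_trans leqnn 0 la_sorted) (leq_ltn_trans le_r lt_i) lt_i le_r.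
Qed.

Lemma weakly_above_diagonalE (d : domino) :
  weakly_above_diagonal d = (top_row d <= right_column d).
Proof.
case: d => [[r c] v].
rewrite /weakly_above_diagonal /strictly_below_diagonal /right_column /left_column /top_row /=.
by case: v => /=; lia.
Qed.

Lemma shifted_support_region (la : seq nat) (D : {fset domino}) :
  is_partition la -> shifted_support la D -> shifted_region D.
Proof.
move=> la_part [t [[t_in t_cover] _] ->]; split.
- move=> d e x; rewrite !inE /= => /andP[dt _] /andP[et _] xd xe.
  have /allP/(_ x xd)/t_cover[f [_ uniq_f]] := t_in _ dt.
  by rewrite -(uniq_f d) // -(uniq_f e).
- move=> e x r c; rewrite !inE /= => /andP[et _] xe ler lec rc.
  have /allP/(_ x xe) x_in := t_in _ et.
  have /t_cover[f [[ft fx] _]] := in_diagram_northwest la_part x_in ler lec.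
  (* A domino containing a cell with [r <= c] is not strictly below the diagonal, so [f] has been
     kept. *)
  exists f => //; rewrite !inE /= ft weakly_above_diagonalE.
  by move: fx; rewrite mem_cells /=; lia.
- by move=> d; rewrite !inE /= weakly_above_diagonalE => /andP[].
Qed.

(** An arbitrary relation is allowed because this serves both strictly increasing labels and weakly
    increasing entries. *)
Definition compatible (D : {fset domino}) (R : rel domino) : Prop :=
  forall d e, d \in D -> e \in D -> precedes_in_row d e || precedes_in_column d e -> R d e.

(* The cell in the first row of [d] and the last column of [e] is northeast of a
   cell of [d] weakly above the diagonal, so it is covered. *)
Lemma corner_domino (D : {fset domino}) (d e : domino) :
  shifted_region D -> d \in D -> e \in D ->
  bottom_row d < top_row e -> right_column d < left_column e ->
  exists2 f, f \in D & [/\ f != d, f != e, precedes_in_row d f,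
    precedes_in_column f e & meets_column (right_column e) f].
Proof.
case=> disj nw above dD eD lt_r lt_c.
have dab := above d dD.
have e_cell : (bottom_row e, right_column e) \in cells e.
  by rewrite mem_cells /= /bottom_row /right_column; lia.
have d_cell : (top_row d, right_column d) \in cells d.
  by rewrite mem_cells /= /bottom_row /right_column; lia.
case: (nw _ _ (top_row d) (right_column e) eD e_cell) => /=;
  try by rewrite /bottom_row /right_column in lt_r lt_c dab *; lia.
move=> f fD f_cell.
have fd : f != d.
  apply/eqP => fd; move: f_cell; rewrite fd mem_cells /=.
  by rewrite /right_column in lt_c *; lia.
have fe : f != e.
  by apply/eqP => fe; move: f_cell; rewrite fe mem_cells /= /bottom_row in lt_r *; lia.
exists f => //; split => //.
- apply: precedes_in_rowI d_cell f_cell _ _; last by rewrite eq_sym.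
  by rewrite /right_column in lt_c *; lia.
- by apply: precedes_in_columnI f_cell e_cell _ fe; rewrite /bottom_row in lt_r *; lia.
- by rewrite meets_columnE; move: f_cell; rewrite mem_cells /= => /andP[].
Qed.

(** If the column ranges overlapped as well, the larger top row and the larger left column would
    give a common cell. *)
Lemma disjoint_rectangles (D : {fset domino}) (d e : domino) :
  dominoes_disjoint D -> d \in D -> e \in D -> d != e ->
  top_row d <= bottom_row e -> top_row e <= bottom_row d ->
  right_column d < left_column e \/ right_column e < left_column d.
Proof.
move=> disj dD eD /eqP de r1 r2; apply/orP; apply: contra_notT de => /norP[].
rewrite -!leqNgt => c1 c2.
apply: (disj d e (maxn (top_row d) (top_row e), maxn (left_column d) (left_column e))) => //;
  by rewrite mem_cells /= /bottom_row /right_column in r1 r2 c1 c2 *; lia.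
Qed.

(** Otherwise [e] is left of [d] in a common row, above [d] in a common column, or strictly
    northwest of [d]. In the last case the corner domino comes after [e] in a row and before [d] in
    a column. Each time [R e d] would follow. *)
Lemma not_lower_is_right (D : {fset domino}) (R : rel domino) (d e : domino) :
  shifted_region D -> transitive R -> compatible D R ->
  d \in D -> e \in D -> d != e -> ~~ R e d -> ~~ strictly_lower e d ->
  right_column d < left_column e.
Proof.
move=> reg Rtr Rc dD eD de nR; rewrite strictly_lowerE -leqNgt => r1.
have [disj nw above] := reg; have ed : e != d by rewrite eq_sym.
have cross x y : x \in cells e -> y \in cells d -> x.1 = y.1 -> y.2 <= x.2.
  case: x y => [i j] [i' j'] xe yd /= ii; rewrite leqNgt; apply: contra nR => lt.
  rewrite -ii in yd; apply: Rc => //.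
  by rewrite (precedes_in_rowI xe yd).
have [r2|r2] := leqP (top_row d) (bottom_row e).
  case: (disjoint_rectangles disj dD eD de r2 r1) => // lt; exfalso.
  have := cross (maxn (top_row d) (top_row e), left_column e)
                (maxn (top_row d) (top_row e), left_column d).
  rewrite !mem_cells /= /bottom_row /right_column in r1 r2 lt *; lia.
rewrite ltnNge; apply: contra nR => c1.
have [c2|c2] := leqP (left_column d) (right_column e).
  apply: Rc => //; apply/orP; right.
  apply: (@precedes_in_columnI _ _ (top_row e) (bottom_row d)
            (maxn (left_column d) (left_column e))) => //;
  by rewrite ?mem_cells /= /bottom_row /right_column in r1 r2 c1 c2 *; lia.
have [f fD [_ _ ef fd _]] := corner_domino reg eD dD r2 c2.
by apply: (Rtr f); apply: Rc => //; rewrite ?ef ?fd ?orbT.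
Qed.

(** From the northeast cell of [d], go up its column to row 0, then left along row 0 to the corner.
    The cells where the path turns and ends are weakly above the diagonal, hence covered. *)
Lemma northwest_minimal (D : {fset domino}) (R : rel domino) (d : domino) :
  shifted_region D -> transitive R -> reflexive R -> compatible D R -> d \in D ->
  exists2 f, f \in D & (0, 0) \in cells f /\ R f d.
Proof.
move=> [disj nw above] Rtr Rr Rc dD.
have dab := above d dD.
have d_cell : (top_row d, right_column d) \in cells d.
  by rewrite mem_cells /= /bottom_row /right_column; lia.
have [//|//|//|f fD f00] := nw _ _ 0 0 dD d_cell.
have [//|//|//|g gD gc] := nw _ _ 0 (right_column d) dD d_cell.
exists f => //; split => //; apply: (Rtr g).
- have [->|fg] := eqVneq f g; first exact: Rr.
  have [c0|cpos] := posnP (right_column d).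
    by rewrite c0 in gc; rewrite (disj _ _ _ fD gD f00 gc) eqxx in fg.
  by apply: Rc => //; rewrite (precedes_in_rowI f00 gc).
- have [->|gd] := eqVneq g d; first exact: Rr.
  have [r0|rpos] := posnP (top_row d).
    by rewrite r0 in d_cell; rewrite (disj _ _ _ gD dD gc d_cell) eqxx in gd.
  by apply: Rc => //; rewrite (precedes_in_columnI gc d_cell) ?orbT.
Qed.

(* Junk value [0] outside the domain. *)
Definition entry (T : filling) (d : domino) : nat := odflt 0 T.[? d]%fmap.

Lemma entry_val (T : filling) (d : domf T) : entry T (val d) = T d.
Proof. by rewrite /entry -Some_fnd. Qed.

Lemma entriesE (T : filling) : entries T = [seq entry T d | d <- domf T].
Proof.
rewrite /entries enum_fsetE -map_comp.
by apply: eq_map => d /=; rewrite entry_val.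
Qed.

Lemma mem_dominoes_with (T : filling) (a : letter) (d : domino) :
  (d \in dominoes_with T a) = (d \in domf T) && (entry T d == a).
Proof.
rewrite !inE /=; case: (boolP (d \in domf T)) => //= dT.
by rewrite -[d]/(val [` dT]%fset) entry_val -Some_fnd.
Qed.

Lemma value_prm i : value (prm i) = i.
Proof. by rewrite /value /prm; lia. Qed.

Lemma value_unp i : value (unp i) = i.
Proof. by rewrite /value /unp; lia. Qed.

Lemma letterE (a : letter) : a = if odd a then prm (value a) else unp (value a).
Proof. by rewrite /value /unp /prm; case: ifP; lia. Qed.

(** * The order in which standardization numbers dominoes *)

(** Only a preorder: equal letters starting in the same row or column tie. Such ties disappear under
    [row_strict] and [column_strict]. *)
Definition std_le (T : filling) (d e : domino) : bool :=
  (entry T d < entry T e) ||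
  ((entry T d == entry T e) &&
     if odd (entry T d) then top_row d <= top_row e else left_column d <= left_column e).

Definition std_lt (T : filling) (d e : domino) : bool := (d != e) && std_le T d e.

Lemma std_le_trans (T : filling) : transitive (std_le T).
Proof.
move=> e d f /orP[de|/andP[/eqP de lde]] /orP[ef|/andP[/eqP ef lef]];
  rewrite /std_le ?de -?ef ?(ltn_trans de ef) ?de ?ef //.
apply/orP; right; rewrite eqxx /=; move: lde lef; rewrite de -ef.
by case: ifP => _; apply: leq_trans.
Qed.

Lemma pairwise_sort_neq (A : eqType) (f : A -> nat) (s : seq A) :
  uniq s -> pairwise (fun x y => (x != y) && (f x <= f y)) (sort (relpre f leq) s).
Proof.
move=> s_uniq; rewrite pairwise_relI; apply/andP; split.
  by rewrite -uniq_pairwise sort_uniq.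
rewrite -sorted_pairwise; last by move=> ? ? ? /=; apply: leq_trans.
by apply: sort_sorted => x y /=; apply: leq_total.
Qed.

Definition value_block (T : filling) (i : nat) : seq domino :=
  top_to_bottom (dominoes_with T (prm i)) ++ left_to_right (dominoes_with T (unp i)).

Lemma mem_value_block (T : filling) (i : nat) (d : domino) :
  (d \in value_block T i) = (d \in domf T) && (value (entry T d) == i).
Proof.
rewrite mem_cat !mem_sort !mem_dominoes_with -andb_orr; congr (_ && _).
by rewrite /value /prm /unp; lia.
Qed.

Lemma pairwise_left_to_right (T : filling) (i : nat) :
  pairwise (std_lt T) (left_to_right (dominoes_with T (unp i))).
Proof.
have := pairwise_sort_neq left_column (fset_uniq (dominoes_with T (unp i))).
apply: (sub_in_pairwise (P := mem (dominoes_with T (unp i)))); last first.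
  by apply/allP => d; rewrite mem_sort.
move=> d e; rewrite !mem_dominoes_with => /andP[_ /eqP Td] /andP[_ /eqP Te].
move=> /andP[de le_c]; rewrite /std_lt de /std_le Td Te ltnn eqxx /= le_c.
by rewrite /unp odd_double.
Qed.

(** For [i = 0] the letters [prm i] and [unp i] coincide and the block would list its dominoes
    twice. *)
Lemma pairwise_value_block (T : filling) (i : nat) :
  0 < i -> pairwise (std_lt T) (value_block T i).
Proof.
move=> i_gt0; rewrite pairwise_cat pairwise_left_to_right andbT; apply/andP; split.
  apply/allrelP => d e; rewrite !mem_sort !mem_dominoes_with.
  move=> /andP[_ /eqP Td] /andP[_ /eqP Te]; rewrite /std_lt /std_le Td Te.
  have lt : prm i < unp i by rewrite /prm /unp; lia.
  by rewrite lt andbT; apply/eqP => de; move: lt; rewrite -Td -Te de ltnn.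
have := pairwise_sort_neq top_row (fset_uniq (dominoes_with T (prm i))).
apply: (sub_in_pairwise (P := mem (dominoes_with T (prm i)))); last first.
  by apply/allP => d; rewrite mem_sort.
move=> d e; rewrite !mem_dominoes_with => /andP[_ /eqP Td] /andP[_ /eqP Te].
move=> /andP[de le_c]; rewrite /std_lt de /std_le Td Te ltnn eqxx /= le_c.
by have -> : odd (prm i) by rewrite /prm; lia.
Qed.

Lemma std_lt_value (T : filling) (d e : domino) :
  value (entry T d) < value (entry T e) -> std_lt T d e.
Proof.
move=> lt; have ltT : entry T d < entry T e by move: lt; rewrite /value; lia.
by rewrite /std_lt /std_le ltT andbT; apply/eqP => de; rewrite de ltnn in lt.
Qed.

Lemma pairwise_flatten_blocks (T : filling) (vs : seq nat) :
  pairwise ltn vs -> all (leq 1) vs ->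
  pairwise (std_lt T) (flatten [seq value_block T i | i <- vs]).
Proof.
elim: vs => //= i vs IH /andP[i_lt vs_lt] /andP[i_gt0 vs_gt0].
rewrite pairwise_cat pairwise_value_block // IH // andbT; rewrite andbT.
apply/allrelP => d e; rewrite mem_value_block => /andP[_ /eqP di].
move=> /flatten_mapP[j j_vs]; rewrite mem_value_block => /andP[_ /eqP ej].
by apply: std_lt_value; rewrite di ej; exact: (allP i_lt).
Qed.

Lemma mem_positive_values (T : filling) (d : domino) :
  d \in domf T -> 0 < value (entry T d) -> value (entry T d) \in positive_values T.
Proof.
move=> dT pos; have dE : entry T d \in entries T by rewrite entriesE map_f.
rewrite mem_filter mem_iota pos add1n ltnS (leq_bigmax_seq _ dE) //.
rewrite /wt -lt0n -has_count; apply/andP; split => //; apply/hasP.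
by exists (entry T d).
Qed.

Lemma mem_std_order (T : filling) (d : domino) : (d \in std_order T) = (d \in domf T).
Proof.
rewrite mem_cat mem_sort mem_dominoes_with.
apply/orP/idP => [[/andP[]//|/flatten_mapP[i _]]|dT].
  by rewrite mem_value_block => /andP[].
have [v0|pos] := posnP (value (entry T d)).
  by left; rewrite dT; apply/eqP; move: v0; rewrite /value /unp; lia.
right; apply/flatten_mapP; exists (value (entry T d)); first exact: mem_positive_values.
by rewrite mem_value_block dT eqxx.
Qed.

Lemma pairwise_std_order (T : filling) : pairwise (std_lt T) (std_order T).
Proof.
rewrite pairwise_cat pairwise_left_to_right; apply/and3P; split => //.
  apply/allrelP => d e; rewrite mem_sort mem_dominoes_with => /andP[_ /eqP d0].
  move=> /flatten_mapP[i]; rewrite mem_filter mem_iota => /and3P[_ i_gt0 _].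
  rewrite mem_value_block => /andP[_ /eqP ei]; apply: std_lt_value.
  by rewrite d0 ei value_unp.
apply: pairwise_flatten_blocks.
  rewrite -sorted_pairwise; last exact: ltn_trans.
  by apply: sorted_filter; [exact: ltn_trans | exact: iota_ltn_sorted].
by apply/allP => i; rewrite mem_filter mem_iota => /and3P[].
Qed.

Lemma std_order_uniq (T : filling) : uniq (std_order T).
Proof.
rewrite uniq_pairwise; apply: sub_pairwise (pairwise_std_order T) => d e.
by case/andP.
Qed.

Lemma perm_std_order (T : filling) : perm_eq (std_order T) (domf T).
Proof.
apply: uniq_perm; [exact: std_order_uniq|exact: fset_uniq|exact: mem_std_order].
Qed.

Definition label (S : filling) (d : domino) : nat := value (entry S d).

Lemma entry_std (T : filling) (d : domino) : d \in domf T ->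
  entry (std T) d =
    let k := (index d (std_order T)).+1 in if odd (entry T d) then prm k else unp k.
Proof.
move=> dT; rewrite -[d in LHS]/(val [` dT]%fset) (@entry_val (std T)) ffunE /=.
by rewrite -entry_val.
Qed.

Lemma label_std (T : filling) (d : domino) :
  d \in domf T -> label (std T) d = (index d (std_order T)).+1.
Proof.
by move=> dT; rewrite /label entry_std //=; case: ifP; rewrite ?value_prm ?value_unp.
Qed.

Lemma odd_entry_std (T : filling) (d : domino) :
  d \in domf T -> odd (entry (std T) d) = odd (entry T d).
Proof.
by move=> dT; rewrite entry_std //=; case: ifP => _; rewrite /prm /unp; lia.
Qed.

Lemma std_lt_of_label (T : filling) (d e : domino) : d \in domf T -> e \in domf T ->
  label (std T) d < label (std T) e -> std_lt T d e.
Proof.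
move=> dT eT; rewrite !label_std // ltnS => lt.
have := pairwise_std_order T => /(pairwiseP d)/(_ _ _ _ _ lt).
by rewrite !inE !index_mem !mem_std_order !nth_index ?mem_std_order //; apply.
Qed.

(** * Standard tableaux read along their labels *)

Definition by_label (S : filling) : seq domino := sort (relpre (label S) leq) (domf S).

(* [MSShDT] in terms of total functions on dominoes *)
Definition labelled (S : filling) : Prop :=
  [/\ shifted_region (domf S), perm_eq [seq label S d | d <- domf S] (iota 1 #|` domf S|)
    & compatible (domf S) (fun d e => label S d < label S e)].

Lemma label_val (S : filling) (d : domf S) : label S (val d) = demark S d.
Proof. by rewrite /label entry_val ffunE. Qed.

Lemma MSShDT_labelled (la : seq nat) (S : filling) :
  is_partition la -> MSShDT la S -> labelled S.
Proof.
move=> la_part [supp perm mono]; split.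
- exact: shifted_support_region supp.
- move: perm; congr perm_eq; rewrite enum_fsetE -map_comp.
  by apply: eq_map => d /=; rewrite label_val.
- move=> d e dS eS prec.
  have := mono [` dS]%fset [` eS]%fset prec.
  by rewrite -!label_val.
Qed.

Lemma map_label_by_label (S : filling) :
  labelled S -> [seq label S d | d <- by_label S] = iota 1 #|` domf S|.
Proof.
case=> _ perm _; rewrite -sort_map; apply: (sorted_eq leq_trans anti_leq).
- exact: sort_sorted leq_total _.
- exact: iota_sorted.
- by rewrite (perm_trans _ perm) // perm_sort.
Qed.

Lemma size_by_label (S : filling) : size (by_label S) = #|` domf S|.
Proof. by rewrite size_sort. Qed.

Lemma mem_by_label (S : filling) (d : domino) : (d \in by_label S) = (d \in domf S).
Proof. by rewrite mem_sort. Qed.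

Lemma by_label_uniq (S : filling) : uniq (by_label S).
Proof. by rewrite sort_uniq fset_uniq. Qed.

Lemma label_nth (S : filling) (x : domino) (j : nat) : labelled S -> j < #|` domf S| ->
  label S (nth x (by_label S) j) = j.+1.
Proof.
move=> Slab jn; rewrite -(nth_map _ 0) ?size_by_label // map_label_by_label //.
by rewrite nth_iota // add1n.
Qed.

Lemma nth_mem_by_label (S : filling) (x : domino) (j : nat) : j < #|` domf S| ->
  nth x (by_label S) j \in domf S.
Proof. by move=> jn; rewrite -mem_by_label mem_nth ?size_by_label. Qed.

Lemma label_index (S : filling) (d : domino) : labelled S -> d \in domf S ->
  label S d = (index d (by_label S)).+1.
Proof.
move=> Slab dS; rewrite -(@label_nth S d) ?nth_index ?mem_by_label //.
by rewrite -size_by_label index_mem mem_by_label.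
Qed.

Lemma label_inj (S : filling) : labelled S -> {in domf S &, injective (label S)}.
Proof.
move=> Slab d e dS eS; rewrite !label_index // => -[eq_i].
by rewrite -(nth_index d (s := by_label S) (x := d)) ?mem_by_label // eq_i
  nth_index ?mem_by_label.
Qed.

Lemma exists_label1 (S : filling) : labelled S -> 0 < #|` domf S| ->
  exists2 d, d \in domf S & label S d = 1.
Proof.
move=> Slab n_gt0; exists (nth ((0, 0), false) (by_label S) 0).
  exact: nth_mem_by_label.
exact: label_nth.
Qed.

Lemma mem_entriesP (S : filling) (a : letter) :
  reflect (exists2 d, d \in domf S & entry S d = a) (a \in entries S).
Proof.
rewrite entriesE; apply: (iffP mapP) => [[d dS ->]|[d dS <-]]; by exists d.
Qed.

(** Labels are distinct, so [d] alone can carry a letter with this value; only its prime remains to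
    be read. In the primed version, positivity excludes [prm 0], which is the unprimed letter 0. *)
Lemma mem_entries_unp (S : filling) (d : domino) : labelled S -> d \in domf S ->
  (unp (label S d) \in entries S) = ~~ odd (entry S d).
Proof.
move=> Slab dS; apply/mem_entriesP/idP => [[e eS eq_e]|even].
  have : label S e = label S d by rewrite /label eq_e value_unp.
  by move/(label_inj Slab eS dS) <-; rewrite eq_e /unp odd_double.
by exists d => //; rewrite /label [LHS]letterE (negbTE even).
Qed.

Lemma mem_entries_prm (S : filling) (d : domino) : labelled S -> d \in domf S ->
  0 < label S d -> (prm (label S d) \in entries S) = odd (entry S d).
Proof.
move=> Slab dS pos; apply/mem_entriesP/idP => [[e eS eq_e]|odd_d].
  have : label S e = label S d by rewrite /label eq_e value_prm.
  by move/(label_inj Slab eS dS) <-; rewrite eq_e /prm; lia.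
by exists d => //; rewrite /label [LHS]letterE odd_d.
Qed.

(** * Descents through consecutive dominoes *)

Lemma descentE (S : filling) (d e : domino) (i : nat) :
  labelled S -> d \in domf S -> e \in domf S ->
  label S d = i.+1 -> label S e = i.+2 -> descent (demark S) i.+1 = strictly_lower e d.
Proof.
move=> Slab dS eS di ei; apply/existsP/idP => [[f /existsP[g]]|lower].
  rewrite -!label_val => /and3P[/eqP fi /eqP gi].
  rewrite (_ : val f = d); last by apply: (label_inj Slab) => //; [exact: valP|rewrite fi].
  by rewrite (_ : val g = e) //; apply: (label_inj Slab) => //; [exact: valP|rewrite gi].
exists [` dS]%fset; apply/existsP; exists [` eS]%fset.
by rewrite -!label_val /= di ei !eqxx.
Qed.

Lemma marked_descentS (S : filling) (d e : domino) (i : nat) :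
  labelled S -> d \in domf S -> e \in domf S -> label S d = i.+1 -> label S e = i.+2 ->
  marked_descent S i.+1 =
    (~~ odd (entry S d) && strictly_lower e d) || (odd (entry S e) && ~~ strictly_lower e d).
Proof.
move=> Slab dS eS di ei; rewrite /marked_descent /= (descentE Slab dS eS di ei).
by rewrite -ei mem_entries_prm ?ei // -di mem_entries_unp.
Qed.

Lemma marked_descent0 (S : filling) (d : domino) :
  labelled S -> d \in domf S -> label S d = 1 ->
  marked_descent S 0 = odd (entry S d) || vertical d.
Proof.
move=> Slab dS d1; rewrite /marked_descent /=; congr (_ || _).
  by rewrite -[1]d1 mem_entries_prm ?d1.
apply/existsP/idP => [[f]|v_d].
  rewrite -entry_val => /andP[/eqP f1].
  by rewrite (_ : val f = d) //; apply: (label_inj Slab) => //; [exact: valP|rewrite d1].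
by exists [` dS]%fset; rewrite -entry_val /= -/(label S d) d1.
Qed.

(** * The semistandard conditions in oriented form *)

(** This and [column_strict] orient the bounds on repeated letters by the comparison that breaks
    ties in [std_le]; odd letters are the primed ones. *)
Definition row_strict (T : filling) : Prop :=
  forall d e, d \in domf T -> e \in domf T -> d != e ->
    odd (entry T d) -> entry T d = entry T e -> top_row d <= top_row e ->
    strictly_lower e d.

Definition column_strict (T : filling) : Prop :=
  forall d e, d \in domf T -> e \in domf T -> d != e ->
    ~~ odd (entry T d) -> entry T d = entry T e -> left_column d <= left_column e ->
    right_column d < left_column e.

Definition corner_condition (T : filling) : Prop :=
  forall d, d \in domf T -> (0, 0) \in cells d -> entry T d = 0 -> ~~ vertical d.

Lemma SSShDTP (la : seq nat) (T : filling) :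
  SSShDT la T <->
  shifted_support la (domf T) /\
  [/\ compatible (domf T) (fun d e => entry T d <= entry T e),
      row_strict T, column_strict T & corner_condition T].
Proof.
split=> -[supp [mono row col corner]]; split=> //; split.
- move=> d e dT eT prec.
  by have := mono [` dT]%fset [` eT]%fset prec; rewrite -!entry_val.
- move=> d e dT eT de odd_d eq_de le_r; rewrite strictly_lowerE ltnNge.
  apply: contra de => r_e; apply/eqP.
  have v_gt0 : 0 < value (entry T d) by rewrite /value; lia.
  have Td : T [` dT]%fset = prm (value (entry T d)).
    by rewrite -entry_val [LHS]letterE odd_d.
  have Te : T [` eT]%fset = prm (value (entry T d)).
    by rewrite -entry_val /= -eq_de [LHS]letterE odd_d.
  (* If [e] is not strictly lower, its top row meets both dominoes. The column case below uses the
     left column of [e] in the same way. *)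
  have := row _ (top_row e) _ _ v_gt0 Td Te; rewrite !meets_rowE /= le_r r_e leqnn.
  by move=> /(_ isT (leq_addr _ _))/(congr1 val).
- move=> d e dT eT de even_d eq_de le_c; rewrite ltnNge.
  apply: contra de => c_e; apply/eqP.
  have Td : T [` dT]%fset = unp (value (entry T d)).
    by rewrite -entry_val [LHS]letterE (negbTE even_d).
  have Te : T [` eT]%fset = unp (value (entry T d)).
    by rewrite -entry_val /= -eq_de [LHS]letterE (negbTE even_d).
  have := col _ (left_column e) _ _ Td Te; rewrite !meets_columnE /= le_c c_e leqnn.
  by move=> /(_ isT (leq_addr _ _))/(congr1 val).
- move=> d dT d00 Td; apply: (corner [` dT]%fset) => //.
  by rewrite -entry_val.
- by move=> d e; rewrite -!entry_val; apply: mono; apply: valP.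
- move=> i r d e i_gt0; rewrite -!entry_val !meets_rowE => Td Te rd re.
  apply: contrapT => /eqP de; have odd_d : odd (entry T (val d)) by rewrite Td /prm; lia.
  wlog le_r : d e Td Te rd re de odd_d / top_row (val d) <= top_row (val e).
    move=> wl; have [le|/ltnW le] := leqP (top_row (val d)) (top_row (val e)).
      exact: (wl d e).
    by apply: (wl e d) => //; [rewrite eq_sym | rewrite Te -Td].
  have := row _ _ (valP d) (valP e) de odd_d _ le_r; rewrite Td Te strictly_lowerE.
  by move/(_ erefl); lia.
- move=> i c d e; rewrite -!entry_val !meets_columnE => Td Te cd ce.
  apply: contrapT => /eqP de.
  have even_d : ~~ odd (entry T (val d)) by rewrite Td /unp odd_double.
  wlog le_c : d e Td Te cd ce de even_d / left_column (val d) <= left_column (val e).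
    move=> wl; have [le|/ltnW le] := leqP (left_column (val d)) (left_column (val e)).
      exact: (wl d e).
    by apply: (wl e d) => //; [rewrite eq_sym | rewrite Te -Td].
  have := col _ _ (valP d) (valP e) de even_d _ le_c; rewrite Td Te.
  by move/(_ erefl); lia.
- by move=> d d00; rewrite -entry_val; apply: corner (valP d) d00.
Qed.

(** * From tableaux to sequences *)

Definition values (S T : filling) : seq nat := [seq value (entry T d) | d <- by_label S].

Lemma size_values (S T : filling) : size (values S T) = #|` domf S|.
Proof. by rewrite size_map size_by_label. Qed.

Lemma count_values (S T : filling) (k : nat) :
  domf S = domf T -> count_mem k (values S T) = wt T k.
Proof.
move=> domST; rewrite /wt entriesE !count_map -domST.
by apply/permP; rewrite perm_sort.
Qed.

(** By [northwest_minimal] for the weak comparison of labels, some domino covering the corner has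
    label at most 1; labels are positive and distinct, so it is [d]. *)
Lemma label1_corner (S : filling) (d : domino) :
  labelled S -> d \in domf S -> label S d = 1 -> (0, 0) \in cells d.
Proof.
move=> Slab dS d1; have [reg _ mono] := Slab.
have tr : transitive (fun d e => label S d <= label S e) by move=> ? ? ?; apply: leq_trans.
have rf : reflexive (fun d e => label S d <= label S e) by move=> ?; apply: leqnn.
have wmono : compatible (domf S) (fun d e => label S d <= label S e).
  by move=> e f eS fS /(mono _ _ eS fS)/ltnW.
have [f fS [f00 le_f]] := northwest_minimal reg tr rf wmono dS.
suff -> : d = f by [].
apply: (label_inj Slab) => //; apply/eqP; rewrite eqn_leq le_f andbT d1.
by rewrite label_index.
Qed.

(** Three cases remain: [d] primed and [e] unprimed; both primed, with [e] strictly lower; both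
    unprimed, with [e] to the right. In the last, if [e] were strictly lower, the letter of the
    corner domino would be squeezed between equal letters, and that domino shares a column with
    [e]. *)
Lemma equal_entries_not_descent (T : filling) (d e : domino) (i : nat) :
  shifted_region (domf T) -> compatible (domf T) (fun d e => entry T d <= entry T e) ->
  row_strict T -> column_strict T -> d \in domf T -> e \in domf T ->
  std_lt T d e -> value (entry T d) = value (entry T e) ->
  ~~ ((~~ odd (entry T d) && strictly_lower e d) ||
      (odd (entry T e) && ~~ strictly_lower e d)).
Proof.
move=> reg mono row col dT eT /andP[de le_de] eq_v.
case/orP: le_de => [lt|/andP[/eqP eq_de]].
  have -> : odd (entry T d) by move: eq_v lt; rewrite /value; lia.
  by have -> : odd (entry T e) = false by move: eq_v lt; rewrite /value; lia.
rewrite -eq_de; case: ifP => [odd_d le_r|/negbT even_d le_c].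
  by rewrite (row _ _ dT eT de odd_d eq_de le_r).
rewrite /= orbF strictly_lowerE; apply/negP => lower.
have lt_c := col _ _ dT eT de even_d eq_de le_c.
have [f fT [_ fe df f_e fc]] := corner_domino reg dT eT lower lt_c.
have le1 : entry T d <= entry T f by apply: mono => //; rewrite df.
have le2 : entry T f <= entry T e by apply: mono => //; rewrite f_e orbT.
have eq_f : entry T f = entry T e by apply/eqP; rewrite eqn_leq le2 -eq_de le1.
have even_f : ~~ odd (entry T f) by rewrite eq_f -eq_de.
move: fc; rewrite meets_columnE.
have [le_fe|/ltnW le_ef] := leqP (left_column f) (left_column e).
  have := col _ _ fT eT fe even_f eq_f le_fe.
  by rewrite /right_column; lia.
have := col e f eT fT; rewrite eq_sym fe -eq_f even_f.
by move=> /(_ isT isT erefl le_ef); lia.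
Qed.

Lemma SSShDT_FB_index (la : seq nat) (S T : filling) :
  is_partition la -> labelled S -> SSShDT la T -> std T = S ->
  forall t : (#|` domf S|).-tuple nat, tval t = values S T -> FB_index (Des S) t.
Proof.
move=> la_part Slab /SSShDTP[supp [mono row col corner]] stdT t tE j.
have domST : domf S = domf T by rewrite -stdT.
have [x0 x0S x0_1] := exists_label1 Slab (leq_ltn_trans (leq0n j) (ltn_ord j)).
have dom_odd d : d \in domf S -> odd (entry S d) = odd (entry T d).
  by move=> dS; rewrite -stdT odd_entry_std // -domST.
have tn i : i < #|` domf S| -> nth 0 t i = value (entry T (nth x0 (by_label S) i)).
  by move=> lt; rewrite tE (nth_map x0) ?size_by_label.
rewrite inE; case: j => -[|i] /= lt_i.
  (* Index 0 compares the first value with 0. If that value is 0, then [x0] carries the unprimed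
     letter 0 and covers the corner, so it is horizontal and 0 is not a descent. *)
  split=> //; rewrite tn // (_ : nth _ _ _ = x0); last first.
    by apply: (label_inj Slab); rewrite ?nth_mem_by_label // label_nth.
  rewrite (marked_descent0 Slab x0S x0_1) dom_odd // lt0n; apply: contraL => /eqP v0.
  have Tx0 : entry T x0 = 0 by move: v0; rewrite /value; lia.
  rewrite Tx0 /=; apply: corner Tx0; first by rewrite -domST.
  exact: label1_corner x0S x0_1.
(* Positions [i] and [i.+1] of [t], counted from 0, belong to the dominoes labelled [i.+1] and
   [i.+2]. *)
have lt_i' := ltnW lt_i; rewrite !tn //.
set d := nth x0 _ i; set e := nth x0 _ i.+1.
have dS : d \in domf S by exact: nth_mem_by_label.
have eS : e \in domf S by exact: nth_mem_by_label.
have di : label S d = i.+1 by exact: label_nth.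
have ei : label S e = i.+2 by exact: label_nth.
have lt_de : std_lt T d e.
  by apply: std_lt_of_label; rewrite -?domST // stdT di ei.
have le_v : value (entry T d) <= value (entry T e).
  by case/andP: lt_de => _ /orP[/ltnW|/andP[/eqP->]] //; rewrite /value; lia.
split=> //; rewrite (marked_descentS Slab dS eS di ei) !dom_odd // => desc.
rewrite ltn_neqAle le_v andbT; apply: contraL desc => /eqP.
by apply: equal_entries_not_descent; rewrite -?domST //; [case: Slab | rewrite domST].
Qed.

Lemma filling_eq (T U : filling) : domf T = domf U ->
  (forall d, d \in domf T -> entry T d = entry U d) -> T = U.
Proof.
move=> domTU eqTU; apply/fmapP => d.
have [dT|dT] := boolP (d \in domf T); last first.
  have dU : d \notin domf U by rewrite -domTU.
  by rewrite !not_fnd.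
have dU : d \in domf U by rewrite -domTU.
by have := eqTU d dT; rewrite /entry (in_fnd dT) (in_fnd dU) /= => ->.
Qed.

(** * From sequences to tableaux *)

Definition value_at (S : filling) (s : seq nat) (d : domino) : nat :=
  nth 0 s (index d (by_label S)).

(** The candidate preimage of [s]: standardization keeps primes, so they are taken from [S]. *)
Definition of_values (S : filling) (s : seq nat) : filling :=
  [fmap d : domf S =>
     if odd (S d) then prm (value_at S s (val d)) else unp (value_at S s (val d))]%fmap.

(* The letter of [d] shifted up by one, with [0] for the letter [0'] that the
   alphabet lacks. *)
Definition code (S : filling) (s : seq nat) (d : domino) : nat :=
  (value_at S s d).*2 + ~~ odd (entry S d).

Lemma entry_of_values (S : filling) (s : seq nat) (d : domino) :
  d \in domf S -> entry (of_values S s) d = (code S s d).-1.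
Proof.
move=> dS; rewrite -[d in LHS]/(val [` dS]%fset) (@entry_val (of_values S s)) ffunE /=.
by rewrite -entry_val /code /=; case: odd; rewrite /prm /unp; lia.
Qed.

(** Odd codes are the unprimed letters. Ties are broken by strict geometric relations, which are
    transitive, so that checking consecutive labels settles all pairs. *)
Definition code_lt (S : filling) (s : seq nat) (d e : domino) : bool :=
  (code S s d < code S s e) ||
  ((code S s d == code S s e) &&
     if odd (code S s d) then right_column d < left_column e else strictly_lower e d).

Lemma code_lt_trans (S : filling) (s : seq nat) : transitive (code_lt S s).
Proof.
move=> e d f /orP[de|/andP[/eqP de lde]] /orP[ef|/andP[/eqP ef lef]];
  rewrite /code_lt ?de -?ef ?(ltn_trans de ef) ?de ?ef //.
apply/orP; right; rewrite eqxx /=; move: lde lef; rewrite de -ef !strictly_lowerE.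
by case: ifP => _; rewrite /right_column /bottom_row; lia.
Qed.

Lemma value_at_nth (S : filling) (s : seq nat) (x : domino) (i : nat) :
  i < #|` domf S| -> value_at S s (nth x (by_label S) i) = nth 0 s i.
Proof. by move=> lt; rewrite /value_at index_uniq ?by_label_uniq ?size_by_label. Qed.

Lemma sorted_code_lt (S : filling) (t : (#|` domf S|).-tuple nat) :
  labelled S -> FB_index (Des S) t -> sorted (code_lt S t) (by_label S).
Proof.
move=> Slab tF; apply/(sortedP ((0, 0), false)) => i; rewrite size_by_label => lt_i.
set d := nth _ _ i; set e := nth _ _ i.+1.
have lt_i' := ltnW lt_i.
have dS : d \in domf S by exact: nth_mem_by_label.
have eS : e \in domf S by exact: nth_mem_by_label.
have di : label S d = i.+1 by exact: label_nth.
have ei : label S e = i.+2 by exact: label_nth.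
have := tF (Ordinal lt_i); rewrite inE (marked_descentS Slab dS eS di ei) /=.
have -> : nth 0 t i = value_at S t d by rewrite value_at_nth.
have -> : nth 0 t i.+1 = value_at S t e by rewrite value_at_nth.
case=> le_v lt_v; rewrite /code_lt /code.
have [reg _ mono] := Slab.
have right_of : ~~ strictly_lower e d -> right_column d < left_column e.
  apply: (@not_lower_is_right (domf S) (fun d e => label S d < label S e)) => //.
  - by move=> ? ? ?; apply: ltn_trans.
  - by apply/eqP => de; have := congr1 (label S) de; rewrite di ei; lia.
  - by rewrite di ei; lia.
move: (value_at S t d) (value_at S t e) le_v lt_v => v w le_v.
(* Both primed: a descent unless [e] is strictly lower. Primed then unprimed: never a descent, and
   the code increases anyway. Unprimed then primed: always a descent. Both unprimed: a descent
   exactly when [e] is strictly lower, and otherwise [e] is to the right. *)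
case: (odd (entry S d)) (odd (entry S e)) => -[] /=; rewrite ?andbT ?andbF ?orbF.
- case: (boolP (strictly_lower e d)) => low lt_v; last by move: (lt_v isT); lia.
  by rewrite !addn0 odd_double andbT orbC -leq_eqVlt leq_double.
- by move=> _; apply/orP; left; lia.
- by rewrite orbN => /(_ isT) lt_v; apply/orP; left; lia.
- case: (boolP (strictly_lower e d)) => low lt_v.
    by apply/orP; left; move: (lt_v isT); lia.
  have -> : odd (v.*2 + 1) by lia.
  by rewrite right_of // andbT orbC -leq_eqVlt leq_add2r leq_double.
Qed.

Lemma code_lt_of_label (S : filling) (s : seq nat) (d e : domino) :
  labelled S -> sorted (code_lt S s) (by_label S) -> d \in domf S -> e \in domf S ->
  label S d < label S e -> code_lt S s d e.
Proof.
move=> Slab; rewrite sorted_pairwise; last exact: code_lt_trans.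
move=> /(pairwiseP d) pw dS eS; rewrite !label_index // ltnS => /pw.
by rewrite !inE !index_mem !mem_by_label !nth_index ?mem_by_label //; apply.
Qed.

Lemma code_lt_leq (S : filling) (s : seq nat) (d e : domino) :
  code_lt S s d e -> code S s d <= code S s e.
Proof. by case/orP => [/ltnW|/andP[/eqP->]]. Qed.

Lemma value_at_label1 (S : filling) (t : (#|` domf S|).-tuple nat) (d : domino) :
  labelled S -> FB_index (Des S) t -> d \in domf S -> label S d = 1 ->
  odd (entry S d) || vertical d -> 0 < value_at S t d.
Proof.
move=> Slab tF dS d1; rewrite -(marked_descent0 Slab dS d1) => desc.
have n_gt0 : 0 < #|` domf S| by rewrite cardfs_gt0; apply/fset0Pn; exists d.
have [_] := tF (Ordinal n_gt0); rewrite inE /= => /(_ desc).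
by move: d1; rewrite /value_at label_index // => -[->].
Qed.

(** The missing letter 0' never arises: if the domino labelled 1 is primed, then 0 is a descent and
    its value is positive; codes weakly increase with labels from there. *)
Lemma code_gt0 (S : filling) (t : (#|` domf S|).-tuple nat) (d : domino) :
  labelled S -> FB_index (Des S) t -> d \in domf S -> 0 < code S t d.
Proof.
move=> Slab tF dS.
have n_gt0 : 0 < #|` domf S| by rewrite cardfs_gt0; apply/fset0Pn; exists d.
have [f fS f1] := exists_label1 Slab n_gt0.
have f_gt0 : 0 < code S t f.
  rewrite /code; case: (boolP (odd (entry S f))) => odd_f; last by rewrite addn1.
  by rewrite addn0 double_gt0; apply: value_at_label1; rewrite ?odd_f.
apply: leq_trans f_gt0 _; have [<-//|fd] := eqVneq f d.
apply/code_lt_leq/code_lt_of_label => //; first exact: sorted_code_lt.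
rewrite f1 ltn_neqAle -f1 (inj_in_eq (label_inj Slab)) // fd f1.
by rewrite label_index.
Qed.

Lemma value_entry_of_values (S : filling) (t : (#|` domf S|).-tuple nat) (d : domino) :
  labelled S -> FB_index (Des S) t -> d \in domf S ->
  value (entry (of_values S t) d) = value_at S t d.
Proof.
move=> Slab tF dS; have := code_gt0 Slab tF dS.
rewrite entry_of_values // /code; move: (value_at S t d) => v.
by case: odd => /=; rewrite /value; lia.
Qed.

Lemma odd_entry_of_values (S : filling) (t : (#|` domf S|).-tuple nat) (d : domino) :
  labelled S -> FB_index (Des S) t -> d \in domf S ->
  odd (entry (of_values S t) d) = odd (entry S d).
Proof.
move=> Slab tF dS; have := code_gt0 Slab tF dS.
rewrite entry_of_values // /code; move: (value_at S t d) => v.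
by case: (odd (entry S d)) => /=; lia.
Qed.

(** Entries are predecessors of positive codes, so no two codes are merged by truncation at 0; the
    labels then decide the direction. *)
Lemma of_values_code_lt (S : filling) (t : (#|` domf S|).-tuple nat) (d e : domino) :
  labelled S -> FB_index (Des S) t -> d \in domf S -> e \in domf S -> d != e ->
  entry (of_values S t) d = entry (of_values S t) e ->
  code S t d = code S t e /\ (code_lt S t d e \/ code_lt S t e d).
Proof.
move=> Slab tF dS eS de; rewrite !entry_of_values // => eq_de.
have := code_gt0 Slab tF dS; have := code_gt0 Slab tF eS => e_gt0 d_gt0; split; first lia.
have tS := sorted_code_lt Slab tF.
have [lt|lt|eq_l] := ltngtP (label S d) (label S e).
- by left; apply: code_lt_of_label.
- by right; apply: code_lt_of_label.
- by rewrite (label_inj Slab dS eS eq_l) eqxx in de.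
Qed.

Lemma SSShDT_of_values (la : seq nat) (S : filling) (t : (#|` domf S|).-tuple nat) :
  labelled S -> shifted_support la (domf S) -> FB_index (Des S) t ->
  SSShDT la (of_values S t).
Proof.
move=> Slab supp tF; apply/SSShDTP; split=> //; split.
- move=> d e dS eS prec; rewrite !entry_of_values //.
  have [_ _ mono] := Slab.
  have := code_lt_leq (code_lt_of_label Slab (sorted_code_lt Slab tF) dS eS (mono d e dS eS prec)).
  lia.
- move=> d e dS eS de odd_d eq_de le_r.
  have even_c : odd (code S t d) = false.
    by move: odd_d; have := code_gt0 Slab tF dS; rewrite entry_of_values //; lia.
  have [eq_c] := of_values_code_lt Slab tF dS eS de eq_de.
  (* The opposite direction would put [d] strictly below [e], against [le_r]. *)
  rewrite /code_lt -eq_c ltnn eqxx even_c /= => -[//|].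
  by rewrite strictly_lowerE /bottom_row; lia.
- move=> d e dS eS de even_d eq_de le_c.
  have odd_c : odd (code S t d).
    by move: even_d; have := code_gt0 Slab tF dS; rewrite entry_of_values //; lia.
  have [eq_c] := of_values_code_lt Slab tF dS eS de eq_de.
  rewrite /code_lt -eq_c ltnn eqxx odd_c /= => -[//|].
  by rewrite /right_column; lia.
- move=> d dS d00 Td; apply/negP => v_d.
  have n_gt0 : 0 < #|` domf S| by rewrite cardfs_gt0; apply/fset0Pn; exists d.
  have [f fS f1] := exists_label1 Slab n_gt0.
  have [[disj _ _] _ _] := Slab.
  (* By disjointness the domino at the corner is the one labelled 1. If it is vertical, 0 is a
     descent and its value is positive. *)
  have fd := disj _ _ _ fS dS (label1_corner Slab fS f1) d00; subst f.
  have := value_at_label1 Slab tF dS f1; rewrite v_d orbT => /(_ isT).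
  by rewrite -value_entry_of_values // Td.
Qed.

(** Both lists enumerate the same dominoes and are sorted for [std_le], the second because [code_lt]
    implies it. Row and column strictness make [std_le] antisymmetric on these dominoes, so the
    sorted list is unique. *)
Lemma std_order_of_values (S : filling) (t : (#|` domf S|).-tuple nat) :
  labelled S -> FB_index (Des S) t -> row_strict (of_values S t) ->
  column_strict (of_values S t) -> std_order (of_values S t) = by_label S.
Proof.
move=> Slab tF row col; apply: (@sorted_eq_in _ (std_le (of_values S t))).
- by move=> d e f _ _ _; apply: std_le_trans.
- move=> d e; rewrite !mem_std_order /= => dS eS /andP[le_de le_ed].
  apply/eqP; apply: contraT => de.
  have eq_de : entry (of_values S t) d = entry (of_values S t) e.
    by move: le_de le_ed; rewrite /std_le; case: ltngtP.
  move: le_de le_ed; rewrite /std_le eq_de ltnn eqxx /=.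
  case: ifP => [odd_e r1 r2|/negbT even_e c1 c2].
    have := row _ _ dS eS de; rewrite eq_de odd_e => /(_ isT erefl r1).
    by rewrite strictly_lowerE /bottom_row; lia.
  have := col _ _ dS eS de; rewrite eq_de even_e => /(_ isT erefl c1).
  by rewrite /right_column; lia.
- apply: pairwise_sorted; apply: sub_pairwise (pairwise_std_order _) => d e.
  by case/andP.
- apply: pairwise_sorted; have := sorted_code_lt Slab tF.
  rewrite sorted_pairwise; last exact: code_lt_trans.
  apply: (sub_in_pairwise (P := mem (domf S))); last by apply/allP => d; rewrite mem_by_label.
  move=> d e dS eS; have d_gt0 := code_gt0 Slab tF dS; have e_gt0 := code_gt0 Slab tF eS.
  rewrite /code_lt /std_le !entry_of_values // => /orP[lt|/andP[/eqP eq_de]].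
    by apply/orP; left; lia.
  rewrite -eq_de eqxx ltnn /= (_ : odd (code S t d).-1 = ~~ odd (code S t d)); last lia.
  by case: odd => /=; rewrite ?strictly_lowerE /right_column /bottom_row; lia.
- by rewrite (perm_trans (perm_std_order _)) // perm_sym perm_sort.
Qed.

Lemma std_of_values (la : seq nat) (S : filling) (t : (#|` domf S|).-tuple nat) :
  labelled S -> shifted_support la (domf S) -> FB_index (Des S) t ->
  std (of_values S t) = S.
Proof.
move=> Slab supp tF.
have [_ [_ row col _]] := (SSShDTP la _).1 (SSShDT_of_values Slab supp tF).
apply: filling_eq => // d dS.
rewrite entry_std // odd_entry_of_values // std_order_of_values //=.
by rewrite -label_index // [RHS]letterE.
Qed.

Lemma values_of_values (S : filling) (t : (#|` domf S|).-tuple nat) :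
  labelled S -> FB_index (Des S) t -> values S (of_values S t) = t.
Proof.
move=> Slab tF; apply: (@eq_from_nth _ 0); rewrite size_values ?size_tuple // => i lt_i.
rewrite (nth_map ((0, 0), false)) ?size_by_label //.
by rewrite value_entry_of_values ?nth_mem_by_label // value_at_nth.
Qed.

(** * Uniqueness and comparison of coefficients *)

(** A letter is its value together with its prime, and the prime can be read from the
    standardization. *)
Lemma std_values_inj (S T U : filling) :
  std T = S -> std U = S -> values S T = values S U -> T = U.
Proof.
move=> stdT stdU /eq_in_map eq_v.
have domST : domf S = domf T by rewrite -stdT.
have domSU : domf S = domf U by rewrite -stdU.
apply: filling_eq; first by rewrite -domST.
move=> d dT; have dS : d \in domf S by rewrite domST.
have dU : d \in domf U by rewrite -domSU.
rewrite [LHS]letterE [RHS]letterE -(odd_entry_std dT) -(odd_entry_std dU) stdT stdU.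
by rewrite eq_v ?mem_by_label.
Qed.

Lemma FB_index_sorted (n : nat) (I : {set 'I_n}) (t : n.-tuple nat) :
  FB_index I t -> sorted leq t.
Proof.
move=> tF; apply/(sortedP 0) => i; rewrite size_tuple => lt_i.
by have [] := tF (Ordinal lt_i).
Qed.

Lemma FB_index_inj (n : nat) (I J : {set 'I_n}) (s t : n.-tuple nat) :
  FB_index I s -> FB_index J t -> FB_exponent s =1 FB_exponent t -> s = t.
Proof.
move=> sF tF eq_st; apply/val_inj/(sorted_eq leq_trans anti_leq).
- exact: FB_index_sorted sF.
- exact: FB_index_sorted tF.
- by apply/allP => k _; apply/eqP; apply: eq_st.
Qed.

Lemma finite_is_subset1 (A : choiceType) (X : set A) : is_subset1 X -> finite_set X.
Proof.
move=> X1; have [-> //|/set0P[a Xa]] := eqVneq X set0.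
by apply: sub_finite_set (finite_set1 a) => b Xb; apply: X1.
Qed.

(** With at most one element on each side, sizes agree as soon as the sets are nonempty together,
    which spares building a bijection. *)
Lemma card_fset_set_subset1 (A B : choiceType) (X : set A) (Y : set B) :
  is_subset1 X -> is_subset1 Y -> (X !=set0 <-> Y !=set0)%classic ->
  #|` fset_set X| = #|` fset_set Y|.
Proof.
move=> X1 Y1 XY.
have [X0|/set0P Xn] := eqVneq X set0.
  have -> : Y = set0.
    by apply/eqP; apply: contraT => /set0P/XY; rewrite X0 => -[].
  by rewrite X0 !fset_set0 !cardfs0.
have [a Xa] := Xn; have [b Yb] := XY.1 Xn.
have -> : X = [set a]%classic by apply/seteqP; split=> x; [move=> Xx; exact: X1 | move=> ->].
have -> : Y = [set b]%classic by apply/seteqP; split=> y; [move=> Yy; exact: Y1 | move=> ->].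
by rewrite !fset_set1 !cardfs1.
Qed.

Theorem theorem4p6 (la : seq nat) (S : filling) :
  is_partition la ->
  shifted_condition (two_quotient la) ->
  MSShDT la S ->
  let X : set filling := [set T | SSShDT la T /\ std T = S]%classic in
  [/\ summable X wt,
      summable (FB_index (Des S)) (@FB_exponent #|` domf S|)
    & monomial_sum X wt = FB (Des S)].
Proof.
move=> la_part _ S_std X.
have Slab := MSShDT_labelled la_part S_std.
have supp : shifted_support la (domf S) by case: S_std.
have X_to_F e T : with_exponent X wt e T ->
    exists2 t : (#|` domf S|).-tuple nat,
      tval t = values S T & with_exponent (FB_index (Des S)) (@FB_exponent _) e t.
  case=> -[TX stdT] wtT; exists (Tuple (introT eqP (size_values S T))) => //; split.
    exact: SSShDT_FB_index TX stdT _ _.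
  by move=> k; rewrite -wtT -(@count_values S) // -stdT.
have F1 e : is_subset1 (with_exponent (FB_index (Des S)) (@FB_exponent #|` domf S|) e).
  move=> s t [sF ws] [tF wt_]; apply: FB_index_inj sF tF _ => k.
  by rewrite ws wt_.
(* Equal weights give sequences of equal content, which coincide by [F1]; the sequence and [S] then
   determine the tableau. *)
have X1 e : is_subset1 (with_exponent X wt e).
  move=> T U TX UX; have [s sE sF] := X_to_F e T TX; have [t tE tF] := X_to_F e U UX.
  case: TX UX => -[_ stdT] _ [[_ stdU] _]; apply: std_values_inj stdT stdU _.
  by rewrite -sE -tE (F1 e s t).
split.
- by move=> e; apply: finite_is_subset1.
- by move=> e; apply: finite_is_subset1.
- apply/funext => e; congr Posz; apply: card_fset_set_subset1 => //; split.
    by case=> T /X_to_F[t _ tF]; exists t.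
  (* Conversely, a sequence yields the tableau [of_values S t], whose values along the labels of [S]
     are [t] again, so the weight is the content of [t]. *)
  case=> t [tF wt_t]; exists (of_values S t); split; first split.
  + exact: SSShDT_of_values.
  + exact: std_of_values supp tF.
  + by move=> k; rewrite -wt_t -(@count_values S) // values_of_values.
Qed.
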